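(* Let $\mathcal{G}=(V,T,P,s)$ be a regular tree grammar and let $L$ be the language of $\mathcal{G}$. Then the map $\phi:\mathrm{L}(\mathrm{RTG}(\mathcal{G}))\to L$ defined by $\phi((a,\mathfrak{t},u)):=\mathfrak{t}_{a,u}$ is a bijection between the language of $\mathrm{RTG}(\mathcal{G})$ and $L$.
   Context: Bud operads and bud generating systems. A (monochrome) operad $\mathcal{O}=\bigsqcup_{n\geq1}\mathcal{O}(n)$ is a nonsymmetric set-operad with partial compositions $\circ_i:\mathcal{O}(n)\times\mathcal{O}(m)\to\mathcal{O}(n+m-1)$, $1\leq i\leq n$, and a unit $\mathbf{1}\in\mathcal{O}(1)$. For a finite set $\mathscr{C}$ of colors, $\mathbf{Bud}_{\mathscr{C}}(\mathcal{O})$ is the set of triples $(a,x,u)$ with $a\in\mathscr{C}$, $x\in\mathcal{O}(n)$, $u\in\mathscr{C}^n$, $n\geq 1$; $a$ is the output color and $u$ is the word of input colors. The partial composition $(a,x,u)\circ_i(b,y,v)$ is defined iff $b=u_i$ and equals $(a,x\circ_i y,u')$ with $u'$ obtained from $u$ by replacing its $i$-th letter by $v$. The unit of color $a$ is $\mathbf{1}_a=(a,\mathbf{1},a)$. A bud generating system is a tuple $\mathcal{B}=(\mathcal{O},\mathscr{C},\mathfrak{R},I,T)$ with $\mathcal{O}$ an operad, $\mathscr{C}$ a finite set of colors, $\mathfrak{R}$ a finite subset of $\mathbf{Bud}_{\mathscr{C}}(\mathcal{O})$, and $I,T\subseteq\mathscr{C}$. Write $x_1\to x_2$ if $x_2=x_1\circ_i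 r$ for some $r\in\mathfrak{R}$ and some $i$. The language $\mathrm{L}(\mathcal{B})$ is the set of all $x\in\mathbf{Bud}_{\mathscr{C}}(\mathcal{O})$ such that, for some $a\in I$, $x$ is obtained from $\mathbf{1}_a$ by a finite (possibly empty) sequence of steps $\to$ and all input colors of $x$ are in $T$. Free operads. For a graded set $C=\bigsqcup_{n\geq1}C(n)$, $\mathbf{Free}(C)$ is the free operad over $C$: its elements of arity $n$ are the planar rooted trees with $n$ leaves whose internal nodes with $m\geq1$ children are labeled by elements of $C(m)$; $\circ_i$ is grafting on the $i$-th leaf, and the unit is the tree consisting of one leaf. Regular tree grammars. A signature $(V,T)$ consists of a finite alphabet $V=V(0)$ of variables and a finite graded alphabet $T=\bigsqcup_{n\geq0}T(n)$ of terminal symbols. A $(V,T)$-tree is an element of $\mathbf{Bud}_{V\sqcup T(0)}(\mathbf{Free}(T\setminus T(0)))$, i.e. a planar rooted tree whose internal nodes with $n\geq 1$ children are labeled by elements of $T(n)$, and whose output (root edge) and leaves are labeled on $V\sqcup T(0)$. For $\mathfrak{t}\in\mathbf{Free}(T\setminus T(0))$, $a\in V\sqcup T(0)$ and $u\in(V\sqcup T(0))^{|\mathfrak{t}|}$ ($|\mathfrak{t}|$ the number of leaves), $\mathfrak{t}_{a,u}$ denotes the $(V,T)$-tree obtained by labeling the output of $\mathfrak{t}$ by $a$ and its leaves from left to right by the letters of $u$. A regular tree grammar is a tuple $\mathcal{G}=(V,T,P,s)$ where $(V,T)$ is a signature, $P$ is a finite set of pairs $(v,\mathfrak{s})$ (productions)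 with $v\in V$ and $\mathfrak{s}$ a $(V,T)$-tree whose output is labeled by $v$, and $s\in V$ is the start symbol. A $(V,T)$-tree $\mathfrak{t}_2$ is derivable in one step from a $(V,T)$-tree $\mathfrak{t}_1$ if $\mathfrak{t}_1$ has a leaf $y$ labeled by some $a$ and $\mathfrak{t}_2$ is obtained by replacing $y$ by the root of $\mathfrak{s}$ in $\mathfrak{t}_1$, for some production $(a,\mathfrak{s})\in P$; derivability is the reflexive and transitive closure. The language of $\mathcal{G}$ is the set of all $(V,T)$-trees that are derivable from the tree $\mathbf{1}_s$ consisting of one leaf labeled by $s$ (with output $s$) and whose leaves are all labeled on $T(0)$. The construction. $\mathrm{RTG}(\mathcal{G})$ is the bud generating system $(\mathbf{Free}(T\setminus T(0)),\,V\sqcup T(0),\,\mathfrak{R},\,\{s\},\,T(0))$ with $\mathfrak{R}=\{(a,\mathfrak{t},u)\in\mathbf{Bud}_{V\sqcup T(0)}(\mathbf{Free}(T\setminus T(0))):(a,\mathfrak{t}_{a,u})\in P\}$. *)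

(* Defs.v *)
From Stdlib Require Import Relation_Operators.
From mathcomp Require Import all_boot all_classical.
From mathcomp Require Import zify.

Set Implicit Arguments.
Unset Strict Implicit.
Unset Printing Implicit Defensive.

Local Open Scope classical_set_scope.

(* The disjoint union of the O(n), n >= 1, is given by its total space
   [op_car] together with the arity function.  Positions are numbered from 0:
   [op_comp x i y] is the partial composition at position i + 1.  In the two
   associativity axioms, [k] and [l] are the positions, in the composite, of
   the input at which the second composition is performed. *)
Record operad := Operad {
  op_car :> Type;
  op_arity : op_car -> nat;
  op_unit : op_car;
  op_comp : forall x : op_car, 'I_(op_arity x) -> op_car -> op_car;
  op_arity_gt0 : forall x, 0 < op_arity x;
  op_arity_unit : op_arity op_unit = 1;
  op_arity_comp : forall x (i : 'I_(op_arity x)) y,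
    op_arity (op_comp i y) = (op_arity x + op_arity y).-1;
  op_unitl : forall (i : 'I_(op_arity op_unit)) x, op_comp i x = x;
  op_unitr : forall x (i : 'I_(op_arity x)), op_comp i op_unit = x;
  op_assoc_seq : forall x y z (i : 'I_(op_arity x)) (j : 'I_(op_arity y))
      (k : 'I_(op_arity (op_comp i y))),
    k = i + j :> nat -> op_comp k z = op_comp i (op_comp j z);
  op_assoc_par : forall x y z (i j : 'I_(op_arity x))
      (k : 'I_(op_arity (op_comp i y))) (l : 'I_(op_arity (op_comp j z))),
    i < j -> k = (op_arity y + j).-1 :> nat -> l = i :> nat ->
    op_comp k z = op_comp l y
}.

Record bud (O : operad) (C : finType) := Bud {
  bud_out : C;
  bud_elt : O;
  bud_in : (op_arity bud_elt).-tuple C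
}.

Section Bud.
Context (O : operad) (C : finType).
Implicit Types (x y : bud O C).

Lemma bud_eq x y : bud_out x = bud_out y -> bud_elt x = bud_elt y ->
  bud_in x = bud_in y :> seq C -> x = y.
Proof.
case: x y => [a t u] [b t' v] /= -> e; case: _ / e v => v /val_inj -> //.
Qed.

Definition bud_composable x (i : 'I_(op_arity (bud_elt x))) y : Prop :=
  bud_out y = tnth (bud_in x) i.

Lemma bud_comp_size x (i : 'I_(op_arity (bud_elt x))) y :
  size (take i (bud_in x) ++ bud_in y ++ drop i.+1 (bud_in x))
    == op_arity (op_comp i (bud_elt y)).
Proof.
rewrite op_arity_comp !size_cat size_take size_drop !size_tuple ltn_ord.
have := ltn_ord i; lia.
Qed.

(* Only meaningful when [bud_composable i y] holds. *)
Definition bud_comp x (i : 'I_(op_arity (bud_elt x))) y : bud O C :=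
  @Bud O C (bud_out x) (op_comp i (bud_elt y)) (Tuple (bud_comp_size i y)).

Lemma bud_unit_size (a : C) : size [:: a] == op_arity (op_unit O).
Proof. by rewrite op_arity_unit. Qed.

Definition bud_unit (a : C) : bud O C :=
  @Bud O C a (op_unit O) (Tuple (bud_unit_size a)).

End Bud.

Record bud_system := BudSystem {
  bs_operad : operad;
  bs_color : finType;
  bs_rules : set (bud bs_operad bs_color);
  bs_rules_finite : finite_set bs_rules;
  bs_initial : set bs_color;
  bs_terminal : set bs_color
}.

Definition bs_step (B : bud_system)
    (x1 x2 : bud (bs_operad B) (bs_color B)) : Prop :=
  exists r, exists i : 'I_(op_arity (bud_elt x1)),
    [/\ bs_rules r, bud_composable i r & x2 = bud_comp i r].

Definition bs_language (B : bud_system) :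
    set (bud (bs_operad B) (bs_color B)) :=
  [set x | (exists2 a, bs_initial a &
              clos_refl_trans _ (@bs_step B) (bud_unit (bs_operad B) a) x)
           /\ (forall i, bs_terminal (tnth (bud_in x) i))].

Arguments bs_language : clear implicits.

Record graded_set := GradedSet {
  gs_car :> Type;
  gs_arity : gs_car -> nat;
  gs_arity_gt0 : forall c, 0 < gs_arity c
}.

(* [ltree C L]: planar rooted trees whose internal nodes with m children are
   labeled by symbols of C of arity m, and whose leaves are labeled on L;
   [forest C L n] is the type of sequences of n such trees.  With L = unit,
   these are the elements of the free operad. *)
Inductive ltree (C : graded_set) (L : Type) : Type :=
  | Leaf (l : L)
  | Node (c : C) (f : forest C L (gs_arity c))
with forest (C : graded_set) (L : Type) : nat -> Type :=
  | FNil : forest C L 0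
  | FCons n (t : ltree C L) (f : forest C L n) : forest C L n.+1.

Arguments Leaf {C L} l.
Arguments Node {C L} c f.
Arguments FNil {C L}.
Arguments FCons {C L n} t f.

Scheme ltree_forest_ind := Induction for ltree Sort Prop
  with forest_ltree_ind := Induction for forest Sort Prop.
Combined Scheme ltree_forest_mutind from ltree_forest_ind, forest_ltree_ind.

Section Trees.
Context (C : graded_set).

Fixpoint nleaves L (t : ltree C L) : nat :=
  match t with
  | Leaf _ => 1
  | Node _ f => nleaves_forest f
  end
with nleaves_forest L n (f : forest C L n) : nat :=
  match f with
  | FNil => 0
  | FCons _ t f' => nleaves t + nleaves_forest f'
  end.

Fixpoint leaves L (t : ltree C L) : seq L :=
  match t with
  | Leaf l => [:: l]
  | Node _ f => leaves_forest f
  end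
with leaves_forest L n (f : forest C L n) : seq L :=
  match f with
  | FNil => [::]
  | FCons _ t f' => leaves t ++ leaves_forest f'
  end.

(* Leaves are numbered from 0, from left to right: [graft t i s] replaces the
   i-th leaf of t by the root of s. *)
Fixpoint graft L (t : ltree C L) (i : nat) (s : ltree C L) : ltree C L :=
  match t with
  | Leaf _ => s
  | Node c f => Node c (graft_forest f i s)
  end
with graft_forest L n (f : forest C L n) (i : nat) (s : ltree C L) :
    forest C L n :=
  match f with
  | FNil => FNil
  | FCons _ t f' =>
      if i < nleaves t then FCons (graft t i s) f'
      else FCons t (graft_forest f' (i - nleaves t) s)
  end.

(* [label_leaves t w] labels the leaves of t, from left to right, by
   w 0, w 1, ... *)
Fixpoint label_leaves K L (t : ltree C K) : ('I_(nleaves t) -> L) -> ltree C L :=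
  match t with
  | Leaf _ => fun w => Leaf (w ord0)
  | Node c f => fun w => Node c (label_forest w)
  end
with label_forest K L n (f : forest C K n) :
    ('I_(nleaves_forest f) -> L) -> forest C L n :=
  match f with
  | FNil => fun=> FNil
  | FCons _ t f' => fun w =>
      FCons (label_leaves (fun i => w (lshift (nleaves_forest f') i)))
            (label_forest (fun i => w (rshift (nleaves t) i)))
  end.

Fixpoint unlabel L (t : ltree C L) : ltree C unit :=
  match t with
  | Leaf _ => Leaf tt
  | Node c f => Node c (unlabel_forest f)
  end
with unlabel_forest L n (f : forest C L n) : forest C unit n :=
  match f with
  | FNil => FNil
  | FCons _ t f' => FCons (unlabel t) (unlabel_forest f')
  end.

Lemma nleaves_forest_geq L n (f : forest C L n) : n <= nleaves_forest f.
Proof.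
move: n f; apply: (@forest_ltree_ind C L (fun t => 0 < nleaves t)
  (fun n f => n <= nleaves_forest f)) => //= [c f|n t ht f hf].
  exact/leq_trans/gs_arity_gt0.
by lia.
Qed.

Lemma nleaves_gt0 L (t : ltree C L) : 0 < nleaves t.
Proof.
by case: t => //= c f; apply: leq_trans (nleaves_forest_geq f); apply: gs_arity_gt0.
Qed.

Lemma nleaves_graft L (t s : ltree C L) i :
  i < nleaves t -> nleaves (graft t i s) = (nleaves t + nleaves s).-1.
Proof.
move: t i; apply: (@ltree_forest_ind C L
  (fun t => forall i, i < nleaves t ->
     nleaves (graft t i s) = (nleaves t + nleaves s).-1)
  (fun n f => forall i, i < nleaves_forest f ->
     nleaves_forest (graft_forest f i s)
     = (nleaves_forest f + nleaves s).-1)) => //= n t ht f hf i hi.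
have s0 := nleaves_gt0 s; case: ltnP => hit /=; first by rewrite ht //; lia.
by rewrite hf; lia.
Qed.

Lemma graft_unit (t : ltree C unit) i :
  graft t i (Leaf tt) = t.
Proof.
move: t i; apply: (@ltree_forest_ind C unit
  (fun t => forall i, graft t i (Leaf tt) = t)
  (fun n f => forall i, graft_forest f i (Leaf tt) = f)) => //=.
- by case.
- by move=> c f hf i; rewrite hf.
- by move=> n t ht f hf i; rewrite ht hf; case: ifP.
Qed.

Lemma graft_assoc_seq L (x y z : ltree C L) i j :
  i < nleaves x -> j < nleaves y ->
  graft (graft x i y) (i + j) z = graft x i (graft y j z).
Proof.
move=> hi hj; move: x i hi; apply: (@ltree_forest_ind C L
  (fun x => forall i, i < nleaves x ->
     graft (graft x i y) (i + j) z = graft x i (graft y j z))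
  (fun n f => forall i, i < nleaves_forest f ->
     graft_forest (graft_forest f i y) (i + j) z
     = graft_forest f i (graft y j z))) => //=.
- by move=> _ [].
- by move=> c f hf i hi; rewrite hf.
- move=> n t ht f hf i hi; case: ltnP => hit /=.
    by rewrite nleaves_graft // ifT ?ht //; lia.
  by rewrite ifF -?hf; [congr (FCons _ (graft_forest _ _ _))| |]; lia.
Qed.

Lemma graft_assoc_par L (x y z : ltree C L) i j :
  i < j -> j < nleaves x ->
  graft (graft x i y) (nleaves y + j).-1 z = graft (graft x j z) i y.
Proof.
have y0 := nleaves_gt0 y; have z0 := nleaves_gt0 z.
move: x i j; apply: (@ltree_forest_ind C L
  (fun x => forall i j, i < j -> j < nleaves x ->
     graft (graft x i y) (nleaves y + j).-1 z = graft (graft x j z) i y)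
  (fun n f => forall i j, i < j -> j < nleaves_forest f ->
     graft_forest (graft_forest f i y) (nleaves y + j).-1 z
     = graft_forest (graft_forest f j z) i y)) => //=.
- by move=> _ i j; lia.
- by move=> c f hf i j hij hj; rewrite hf.
- move=> n t ht f hf i j hij hj.
  case: (ltnP j (nleaves t)) => hjt /=.
    have hit := ltn_trans hij hjt.
    rewrite hit /= !nleaves_graft // !ifT ?ht //; lia.
  case: (ltnP i (nleaves t)) => hit /=.
    rewrite nleaves_graft // ifF; last by lia.
    by congr (FCons _ (graft_forest _ _ _)); lia.
  rewrite ifF; last by lia.
  rewrite -hf; [|lia..].
  by congr (FCons _ (graft_forest _ _ _)); lia.
Qed.

Lemma unlabel_label K (t : ltree C unit) (w : 'I_(nleaves t) -> K) :
  unlabel (label_leaves w) = t.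
Proof.
move: t w; apply: (@ltree_forest_ind C unit
  (fun t => forall w : 'I_(nleaves t) -> K, unlabel (label_leaves w) = t)
  (fun n f => forall w : 'I_(nleaves_forest f) -> K,
     unlabel_forest (label_forest w) = f)) => //=.
- by case.
- by move=> c f hf w; rewrite hf.
- by move=> n t ht f hf w; rewrite ht hf.
Qed.

Lemma leaves_label K L (t : ltree C K) (w : 'I_(nleaves t) -> L) :
  leaves (label_leaves w) = [seq w i | i <- enum 'I_(nleaves t)].
Proof.
move: t w; apply: (@ltree_forest_ind C K
  (fun t => forall w : 'I_(nleaves t) -> L,
     leaves (label_leaves w) = [seq w i | i <- enum 'I_(nleaves t)])
  (fun n f => forall w : 'I_(nleaves_forest f) -> L,
     leaves_forest (label_forest w)
     = [seq w i | i <- enum 'I_(nleaves_forest f)])) => //=.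
- by move=> _ w; rewrite enum_ordSl /= (size0nil (size_enum_ord 0)).
- by move=> w; rewrite (size0nil (size_enum_ord 0)).
- move=> n t ht f hf w; rewrite ht hf.
  have -> : enum 'I_(nleaves t + nleaves_forest f)
    = map (@lshift _ _) (enum 'I_(nleaves t))
      ++ map (@rshift _ _) (enum 'I_(nleaves_forest f)).
    apply: (inj_map (@ord_inj _)); rewrite map_cat val_enum_ord iotaD.
    rewrite -(map_comp _ (@lshift _ _)) -(map_comp _ (@rshift _ _)).
    rewrite -[iota 0 _]val_enum_ord -[0 + _]addn0 add0n iotaDl -val_enum_ord.
    by rewrite -(map_comp _ (@nat_of_ord _)).
  by rewrite map_cat -(map_comp _ (@lshift _ _)) -(map_comp _ (@rshift _ _)).
Qed.

End Trees.

Section Free.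
Context (C : graded_set).

Fact free_arity_comp (x : ltree C unit) (i : 'I_(nleaves x)) y :
  nleaves (graft x i y) = (nleaves x + nleaves y).-1.
Proof. exact: nleaves_graft. Qed.

Fact free_assoc_seq (x y z : ltree C unit) (i : 'I_(nleaves x))
    (j : 'I_(nleaves y)) (k : 'I_(nleaves (graft x i y))) :
  k = i + j :> nat -> graft (graft x i y) k z = graft x i (graft y j z).
Proof. by move=> ->; apply: graft_assoc_seq. Qed.

Fact free_assoc_par (x y z : ltree C unit) (i j : 'I_(nleaves x))
    (k : 'I_(nleaves (graft x i y))) (l : 'I_(nleaves (graft x j z))) :
  i < j -> k = (nleaves y + j).-1 :> nat -> l = i :> nat ->
  graft (graft x i y) k z = graft (graft x j z) l y.
Proof. by move=> hij -> ->; apply: graft_assoc_par. Qed.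

Definition free_operad : operad :=
  @Operad (ltree C unit) (@nleaves C unit) (Leaf tt)
    (fun x i y => graft x i y)
    (@nleaves_gt0 C unit) erefl free_arity_comp
    (fun _ _ => erefl) (fun x i => graft_unit x i)
    free_assoc_seq free_assoc_par.

End Free.

Record signature := Signature {
  sg_var : finType;
  sg_term : finType;
  sg_arity : sg_term -> nat
}.

Section Signature.
Context (S : signature).

Definition term0 : finType := {t : sg_term S | sg_arity t == 0}.

Definition term_pos : graded_set :=
  @GradedSet {t : sg_term S | 0 < sg_arity t}
    (fun t => sg_arity (val t)) (fun t => valP t).

Definition sg_color : finType := (sg_var S + term0)%type.

(* A (V,T)-tree, with the labels carried by the leaves themselves and
   [vt_out] the label of the root edge.  [labeled t a u], i.e. t_{a,u}, is the
   passage from a triple (a, t, u) to the corresponding labeled tree. *)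
Record vt_tree := VTTree {
  vt_out : sg_color;
  vt_body : ltree term_pos sg_color
}.

Definition labeled (t : free_operad term_pos) (a : sg_color)
    (u : (op_arity t).-tuple sg_color) : vt_tree :=
  VTTree a (label_leaves (tnth u)).

Definition label_bud (x : bud (free_operad term_pos) sg_color) : vt_tree :=
  labeled (bud_out x) (bud_in x).

Lemma label_bud_inj : injective label_bud.
Proof.
move=> x y [eo eb]; apply: bud_eq => //.
  by rewrite -[LHS](unlabel_label (tnth (bud_in x))) eb unlabel_label.
rewrite -[LHS]map_tnth_enum -[RHS]map_tnth_enum.
by have := congr1 (@leaves _ _) eb; rewrite !leaves_label.
Qed.

End Signature.

Record rtg := RTG {
  rtg_sig : signature;
  rtg_prod : set (sg_var rtg_sig * vt_tree rtg_sig);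
  rtg_prod_finite : finite_set rtg_prod;
  rtg_prod_out : forall p, rtg_prod p -> vt_out p.2 = inl p.1;
  rtg_start : sg_var rtg_sig
}.

Section RTG.
Context (G : rtg).
Let S := rtg_sig G.

Definition rtg_step (t1 t2 : vt_tree S) : Prop :=
  exists (i : 'I_(nleaves (vt_body t1))) (a : sg_var S) (s : vt_tree S),
    [/\ onth (leaves (vt_body t1)) i = Some (inl a), rtg_prod (a, s) &
        t2 = VTTree (vt_out t1) (graft (vt_body t1) i (vt_body s))].

Definition rtg_axiom : vt_tree S :=
  VTTree (inl (rtg_start G)) (Leaf (inl (rtg_start G))).

Definition rtg_language : set (vt_tree S) :=
  [set t | clos_refl_trans _ rtg_step rtg_axiom t
           /\ (forall c, c \in leaves (vt_body t) ->
                 exists b : term0 S, c = inr b)].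

Definition rtg_bud_rules : set (bud (free_operad (term_pos S)) (sg_color S)) :=
  [set x | exists2 a, bud_out x = inl a & rtg_prod (a, labeled (bud_out x) (bud_in x))].

Lemma rtg_bud_rules_finite : finite_set rtg_bud_rules.
Proof.
apply: (@sub_finite_set _ _ (@label_bud S @^-1` (snd @` @rtg_prod G))).
  by move=> x [a _ Px]; exists (a, label_bud x).
apply: finite_preimage; last exact/finite_image/rtg_prod_finite.
by move=> x y _ _; apply: label_bud_inj.
Qed.

Definition rtg_bud_system : bud_system :=
  @BudSystem (free_operad (term_pos S)) (sg_color S) rtg_bud_rules
    rtg_bud_rules_finite [set inl (rtg_start G)] (range inr).

End RTG.

Arguments rtg_language : clear implicits.

(* Main.v *)
Require Import Defs.
From Stdlib Require Import Relation_Operators.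
From mathcomp Require Import all_boot all_classical.
From mathcomp Require Import zify.

(** A tree with labeled leaves is the same thing as its shape (the tree with
    the labels erased) together with the word read on its leaves from left to
    right, so [label_bud], which maps (a, t, u) to t_{a,u}, is a bijection from
    all triples onto all (V,T)-trees; [bud_of] is its inverse. Both descriptions
    compute grafting in the same way: erasing labels commutes with grafting
    ([unlabel_graft]), and grafting at the i-th leaf substitutes a word for the
    i-th letter of the word of leaves ([leaves_graft]), which is how the input
    colors of a partial composition are defined. Hence [label_bud] turns partial
    compositions into graftings ([label_bud_comp]). As it also turns rules into
    productions, it is an isomorphism between the one-step relation of the bud
    system and one-step derivability in the grammar ([rtg_step_label_bud]). It
    sends the colored unit of the start symbol to the starting tree and input
    colors to leaf labels, so it restricts to a bijection between the two
    languages. *)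

Set Implicit Arguments.
Unset Strict Implicit.
Unset Printing Implicit Defensive.

Local Open Scope classical_set_scope.

Section TreeShape.
Context (C : graded_set) (L : Type).

Lemma nleaves_unlabel (t : ltree C L) : nleaves (unlabel t) = nleaves t.
Proof.
move: t; apply: (@ltree_forest_ind C L
  (fun t => nleaves (unlabel t) = nleaves t)
  (fun n f => nleaves_forest (unlabel_forest f) = nleaves_forest f)) => //=.
by move=> n t -> f ->.
Qed.

Lemma size_leaves (t : ltree C L) : size (leaves t) = nleaves t.
Proof.
move: t; apply: (@ltree_forest_ind C L
  (fun t => size (leaves t) = nleaves t)
  (fun n f => size (leaves_forest f) = nleaves_forest f)) => //=.
by move=> n t ht f hf; rewrite size_cat ht hf.
Qed.

Lemma unlabel_graft (t s : ltree C L) i :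
  unlabel (graft t i s) = graft (unlabel t) i (unlabel s).
Proof.
move: t i; apply: (@ltree_forest_ind C L
  (fun t => forall i,
     unlabel (graft t i s) = graft (unlabel t) i (unlabel s))
  (fun n f => forall i, unlabel_forest (graft_forest f i s)
     = graft_forest (unlabel_forest f) i (unlabel s))) => //=.
- by move=> c f hf i; rewrite hf.
- by move=> n t ht f hf i; rewrite nleaves_unlabel; case: ifP => _ /=;
    rewrite ?ht ?hf.
Qed.

Lemma leaves_graft (t s : ltree C L) i : i < nleaves t ->
  leaves (graft t i s) = take i (leaves t) ++ leaves s ++ drop i.+1 (leaves t).
Proof.
move: t i; apply: (@ltree_forest_ind C L
  (fun t => forall i, i < nleaves t -> leaves (graft t i s)
     = take i (leaves t) ++ leaves s ++ drop i.+1 (leaves t))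
  (fun n f => forall i, i < nleaves_forest f ->
     leaves_forest (graft_forest f i s)
     = take i (leaves_forest f) ++ leaves s ++ drop i.+1 (leaves_forest f)))
  => //=.
- by move=> l [] //= _; rewrite cats0.
- move=> n t ht f hf i hi; rewrite take_cat drop_cat size_leaves.
  case: (ltnP i (nleaves t)) => hit /=.
    rewrite ht // -!catA; do 2!congr (_ ++ _).
    (* if i is the last leaf of t, nothing remains of the leaves of t *)
    case: ltnP => // hle; have -> : i.+1 = nleaves t by lia.
    by rewrite -{1}size_leaves drop_size subnn drop0.
  rewrite ifF; last by lia.
  rewrite hf; last by lia.
  by rewrite -catA subSn.
Qed.

(** A tree is recovered from its shape by labeling the leaves of the latter
    with its own word of leaves. The default [d] is irrelevant: all indices are
    in range. *)
Lemma label_leaves_unlabel (t : ltree C L) d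
    (w : 'I_(nleaves (unlabel t)) -> L) :
  (forall i, w i = nth d (leaves t) i) -> label_leaves w = t.
Proof.
move: t w; apply: (@ltree_forest_ind C L
  (fun t => forall w : 'I_(nleaves (unlabel t)) -> L,
     (forall i, w i = nth d (leaves t) i) -> label_leaves w = t)
  (fun n f => forall w : 'I_(nleaves_forest (unlabel_forest f)) -> L,
     (forall i, w i = nth d (leaves_forest f) i) -> label_forest w = f)) => //=.
- by move=> l w ->.
- by move=> c f hf w hw; rewrite hf.
- move=> n t ht f hf w hw.
  rewrite ht => [|i].
    rewrite hf // => i.
    by rewrite hw nth_cat size_leaves -nleaves_unlabel /= ltnNge leq_addr /= addKn.
  by rewrite hw nth_cat size_leaves -nleaves_unlabel /= ltn_ord.
Qed.

End TreeShape.

Section LabelBud.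
Context (S : signature).
Local Notation budS := (bud (free_operad (term_pos S)) (sg_color S)).

Lemma leaves_label_bud (x : budS) :
  leaves (vt_body (label_bud x)) = bud_in x.
Proof. by rewrite leaves_label map_tnth_enum. Qed.

Lemma nleaves_label_bud (x : budS) :
  nleaves (vt_body (label_bud x)) = op_arity (bud_elt x).
Proof. by rewrite -nleaves_unlabel unlabel_label. Qed.

Lemma bud_of_subproof (t : vt_tree S) :
  size (leaves (vt_body t)) == nleaves (unlabel (vt_body t)).
Proof. by rewrite size_leaves nleaves_unlabel. Qed.

(** The triple (a, t, u) read off a (V,T)-tree t_{a,u}. *)
Definition bud_of (t : vt_tree S) : budS :=
  @Bud (free_operad (term_pos S)) (sg_color S) (vt_out t)
    (unlabel (vt_body t)) (Tuple (bud_of_subproof t)).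

Lemma bud_ofK : cancel bud_of (@label_bud S).
Proof.
case=> a t; congr (VTTree a _); apply: (label_leaves_unlabel (d := a)) => i.
by rewrite (tnth_nth a).
Qed.

Lemma label_budK : cancel (@label_bud S) bud_of.
Proof. by move=> x; apply: label_bud_inj; rewrite bud_ofK. Qed.

Lemma label_bud_comp (x r : budS) (i : 'I_(op_arity (bud_elt x))) :
  label_bud (bud_comp i r)
  = VTTree (bud_out x)
      (graft (vt_body (label_bud x)) i (vt_body (label_bud r))).
Proof.
rewrite -[RHS]bud_ofK; congr label_bud; apply: bud_eq => //=.
  by rewrite unlabel_graft !unlabel_label.
rewrite leaves_graft; last by rewrite nleaves_label_bud.
by rewrite !leaves_label_bud.
Qed.

End LabelBud.

Lemma clos_refl_trans_homo (A B : Type) (R : A -> A -> Prop)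
    (R' : B -> B -> Prop) (f : A -> B) :
  (forall x y, R x y -> R' (f x) (f y)) ->
  forall x y, clos_refl_trans A R x y -> clos_refl_trans B R' (f x) (f y).
Proof.
move=> Rf x y; elim=> {x y} [x y /Rf|x|x y z _ xy _ yz]; first exact: rt_step.
  exact: rt_refl.
exact: rt_trans xy yz.
Qed.

Lemma onth_tnth (T : Type) n (u : n.-tuple T) (i : 'I_n) :
  onth u i = Some (tnth u i).
Proof.
rewrite onthE (nth_map (tnth u i)) ?size_tuple //.
by congr Some; rewrite -tnth_nth.
Qed.

Section Grammar.
Context (G : rtg).
Let S := rtg_sig G.
Local Notation budS := (bud (free_operad (term_pos S)) (sg_color S)).

Lemma rtg_step_label_bud (x y : budS) :
  rtg_step (label_bud x) (label_bud y) <-> @bs_step (rtg_bud_system G) x y.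
Proof.
split.
- case=> i [a [s [xi Ps exy]]].
  (* i indexes the leaves of the labeled tree; i' is the same number as an
     input of the triple *)
  pose i' : 'I_(op_arity (bud_elt x)) := cast_ord (nleaves_label_bud x) i.
  exists (bud_of s), i'; have outs : vt_out s = inl a := rtg_prod_out Ps.
  split.
  + by exists a => //; rewrite -/(label_bud _) bud_ofK.
  + rewrite /bud_composable /= outs.
    by have := onth_tnth (bud_in x) i'; rewrite -leaves_label_bud /= xi => -[].
  + by apply: label_bud_inj; rewrite label_bud_comp bud_ofK.
- case=> r [i [[a outr Pr] xi ->]].
  exists (cast_ord (esym (nleaves_label_bud x)) i), a, (label_bud r).
  split=> //; last by rewrite label_bud_comp.
  by rewrite leaves_label_bud onth_tnth -xi outr.
Qed.

Lemma derivable_label_bud (x y : budS) :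
  clos_refl_trans _ (@rtg_step G) (label_bud x) (label_bud y) <->
  clos_refl_trans _ (@bs_step (rtg_bud_system G)) x y.
Proof.
split; last by apply: clos_refl_trans_homo => {}x {}y /rtg_step_label_bud.
rewrite -{2}[x]label_budK -{2}[y]label_budK.
apply: clos_refl_trans_homo => s t st; apply/rtg_step_label_bud.
by rewrite !bud_ofK.
Qed.

Lemma rtg_language_label_bud (x : budS) :
  rtg_language G (label_bud x) <-> bs_language (rtg_bud_system G) x.
Proof.
have unitE := derivable_label_bud
  (bud_unit (free_operad (term_pos S)) (inl (rtg_start G))) x.
split.
- case=> sx lx; split.
    by exists (inl (rtg_start G)) => //; apply: unitE.1.
  move=> i; have [|b ->] := lx (tnth (bud_in x) i); last by exists b.
  by rewrite leaves_label_bud mem_tnth.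
- case=> -[a -> sx] lx; split; first exact: unitE.2.
  move=> c; rewrite leaves_label_bud => /tnthP[i ->].
  by have [b _ <-] := lx i; exists b.
Qed.

End Grammar.

Theorem proposition2p3p2 (G : rtg) :
  set_bij (bs_language (rtg_bud_system G)) (rtg_language G)
    (fun x : bud (free_operad (term_pos (rtg_sig G))) (sg_color (rtg_sig G)) =>
       labeled (bud_out x) (bud_in x)).
Proof.
rewrite -/(@label_bud (rtg_sig G)); split.
- by move=> x Lx; apply/rtg_language_label_bud.
- by move=> x y _ _; apply: label_bud_inj.
- move=> t; rewrite -[t]bud_ofK => /rtg_language_label_bud Lt.
  by exists (bud_of t).
Qed.
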